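(* Let $0<\alpha<1$, $\nu>0$, $T>1$, let $G\subset\mathbb{R}^n$ be a bounded domain with smooth boundary $\partial G$, and put $\Omega=G\times(1,T]$. Let $F$ (on $\overline\Omega$), $\varphi$ (on $\bar G$) and $\psi$ (on $\partial G\times[1,T]$) be continuous, and let $u$ be a solution of $$D_{*,t}^{\alpha}u(x,t)=\nu\Delta_x u(x,t)+F(x,t),\quad (x,t)\in\Omega,$$ with $u(x,1)=\varphi(x)$ for $x\in\bar G$ and $u(x,t)=\psi(x,t)$ for $x\in\partial G$, $1\le t\le T$. If $F(x,t)\ge 0$ for all $(x,t)\in\overline\Omega$, then $$u(x,t)\ \ge\ \min\Bigl\{\min_{\partial G\times[1,T]}\psi,\ \min_{\bar G}\varphi\Bigr\}\quad\text{for all }(x,t)\in\overline\Omega .$$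
   Context: $\Delta_x u=\sum_{j=1}^n\partial^2u/\partial x_j^2$, $\overline\Omega=\bar G\times[1,T]$, and $D_{*,t}^{\alpha}$ is the Hadamard-type fractional derivative in $t$ with base point $1$: $$D_{*,t}^{\alpha}u(x,t)=\frac{1}{\Gamma(1-\alpha)}\int_1^t\left(\log\frac{t}{s}\right)^{-\alpha}\frac{\partial u}{\partial s}(x,s)\,ds .$$ Solutions are classical: $u\in C(\overline\Omega)$ is real-valued, $u(\cdot,t)\in C^2(G)$ for each $t\in(1,T]$, $u(x,\cdot)\in W^1_2([1,T])$ (Sobolev space) for each $x\in G$, the integral defining $D_{*,t}^{\alpha}u(x,t)$ converges absolutely at every $(x,t)\in\Omega$, and the equation holds at every point of $\Omega$. *)

(* Defs.v *)
From HB Require Import structures.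
From mathcomp Require Export all_boot all_order all_algebra.
From mathcomp Require Export all_classical all_reals all_analysis.
Export Order.TTheory GRing.Theory Num.Theory.
Export numFieldNormedType.Exports.

Set Implicit Arguments.
Unset Strict Implicit.
Unset Printing Implicit Defensive.

Local Open Scope classical_set_scope.
Local Open Scope ring_scope.

(* [m] is the minimum (attained infimum) of [f] over [A]. *)
Definition is_min (R : realType) (X : Type) (A : set X) (f : X -> R) (m : R) : Prop :=
  (exists2 x, A x & f x = m) /\ forall x, A x -> m <= f x.

Section Space.
Context (R : realType) (n : nat).
Implicit Types (G U : set 'rV[R]_n) (f : 'rV[R]_n -> R).

Definition boundary G : set 'rV[R]_n := closure G `\` interior G.

Definition partial (i : 'I_n) f : 'rV[R]_n -> R := 'D_(delta_mx 0 i) f.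

Definition laplacian f (x : 'rV[R]_n) : R :=
  \sum_(i < n) partial i (partial i f) x.

(* Meant for open [U]: only the values of [f] on [U] then matter. *)
Fixpoint Ck (k : nat) U f : Prop :=
  (forall x, U x -> {for x, continuous f}) /\
  match k with
  | 0%N => True
  | k'.+1 => forall i : 'I_n,
      (forall x, U x -> derivable f x (delta_mx 0 i)) /\ Ck k' U (partial i f)
  end.

Definition bounded_domain G : Prop :=
  [/\ open G, connected G, G !=set0 & bounded_set G].

(* Near each boundary point, [G] is the side [rho < 0] of the zero set of a
   C^oo function [rho] whose gradient does not vanish at that point. *)
Definition smooth_boundary G : Prop :=
  forall p, boundary G p ->
  exists U rho, [/\ open U, U p, (forall k, Ck k U rho),
    (exists i, partial i rho p != 0) &
    G `&` U = [set x | U x /\ rho x < 0]].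

End Space.

Section Sobolev.
Context (R : realType).
Implicit Types (a b : R) (f g phi : R -> R).
Local Notation mu := (@lebesgue_measure R).

Definition test_function a b phi : Prop :=
  (forall k x, derivable (derive1n k phi) x 1) /\
  closure [set x | phi x != 0] `<=` `]a, b[.

Definition in_L2 a b f : Prop := f \_ `]a, b[ \in Lfun mu 2%:E.

Definition is_weak_derivative a b f g : Prop :=
  forall phi, test_function a b phi ->
    \int[mu]_(s in `]a, b[) (f s * derive1 phi s) =
    - \int[mu]_(s in `]a, b[) (g s * phi s).

Definition in_W12 a b f : Prop :=
  in_L2 a b f /\ exists2 g, in_L2 a b g & is_weak_derivative a b f g.

(* A representative of the weak derivative, which is unique only almost
   everywhere; it is used under integrals only. *)
Definition weak_derivative a b f : R -> R :=
  xget (cst 0) [set g | in_L2 a b g /\ is_weak_derivative a b f g].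

End Sobolev.

Section Hadamard.
Context (R : realType).
Local Notation mu := (@lebesgue_measure R).

Definition Gamma (a : R) : R :=
  \int[mu]_(x in `]0, +oo[) (x `^ (a - 1) * expR (- x)).

(* The derivative of [f], a function on [[1, T]], is the Sobolev one. *)
Definition hadamard_integrand (alpha T : R) (f : R -> R) (t s : R) : R :=
  ln (t / s) `^ (- alpha) * weak_derivative 1 T f s.

Definition hadamard_converges (alpha T : R) (f : R -> R) (t : R) : Prop :=
  mu.-integrable `[1, t] (EFin \o hadamard_integrand alpha T f t).

Definition hadamard (alpha T : R) (f : R -> R) (t : R) : R :=
  (Gamma (1 - alpha))^-1 *
  \int[mu]_(s in `[1, t]) hadamard_integrand alpha T f t s.

Definition continuous_cyl (n : nat) (A : set 'rV[R]_n) (T : R)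
    (v : 'rV[R]_n -> R -> R) : Prop :=
  {within A `*` `[1, T], continuous (fun p : 'rV[R]_n * R => v p.1 p.2)}.

Definition classical_solution (n : nat) (G : set 'rV[R]_n) (alpha nu T : R)
    (F u : 'rV[R]_n -> R -> R) : Prop :=
  [/\ continuous_cyl (closure G) T u,
      (forall t, 1 < t <= T -> Ck 2 G (u^~ t)),
      (forall x, G x -> in_W12 1 T (u x)),
      (forall x t, G x -> 1 < t <= T -> hadamard_converges alpha T (u x) t) &
      (forall x t, G x -> 1 < t <= T ->
         hadamard alpha T (u x) t = nu * laplacian (u^~ t) x + F x t)].

End Hadamard.

(* Main.v *)
Require Import Defs.
From mathcomp Require Import all_boot all_order all_algebra.
From mathcomp Require Import all_classical all_reals all_analysis.
From mathcomp Require Import measurable_realfun.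
From mathcomp Require Import ring lra.

Set Implicit Arguments.
Unset Strict Implicit.
Unset Printing Implicit Defensive.

Local Open Scope classical_set_scope.
Local Open Scope ring_scope.

(** The theorem is a parabolic minimum principle. Suppose that [u] falls below
    the minimum [m] of its initial and lateral values. For a small [eps > 0] the
    function [u - eps |x|^2] still has its minimum over the cylinder at a point
    [(x1, t1)] with [x1] in [G] and [t1 > 1]. In space, the second derivative
    test gives [laplacian u >= 2 n eps > 0] at that point
    ([laplacian_gt0_at_min]). In time, [u x1] attains its minimum over [[1, t1]]
    at the right end, and this forces its Hadamard derivative at [t1] to be
    nonpositive ([hadamard_le0_at_min]). As [F >= 0], the equation cannot hold.

    The second fact is where the work is, because [u x1] has a derivative [g]
    only in the weak sense. Let [f] be continuous with a minimum over [[lo, t]]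
    at [t]. If [g] were a classical derivative, its integral over [[a, t]] would
    be [f t - f a <= 0] for every [a]. The same bound follows from the
    definition of a weak derivative, tested against smooth functions that
    approach the indicator of []a, t[] ([left_minimum_integral_le0]). For a
    nonnegative nondecreasing weight [k], each superlevel set of [k] is an
    interval that ends at [t]; writing [k s] as the integral of the indicators
    of [l <= k s] over [l >= 0] and exchanging the integrals turns the integral
    of [k * g] into an integral of nonpositive numbers
    ([monotone_weight_integral_le0]). The kernel [ln (t / s) `^ (- alpha)] is
    such a weight; its singularity at [s = t] does no harm since only the
    integrability of [k * g] enters, and no boundary term appears.

    The test functions are built from [exp (-1/y)], extended by [0] to [y <= 0].
    Its derivatives are of the form [P(1/y) exp (-1/y)] with [P] a polynomial,
    a class stable under differentiation ([is_derive_flat]). *)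

(** * Smooth functions flat at the origin *)

Section Flat.
Context {R : realType}.
Implicit Types (P : {poly R}) (x y z : R).

(** The extension by [0] of [P(1/y) exp (-1/y)]. Allowing every polynomial [P]
    makes the family stable under differentiation. *)
Definition flat P y : R :=
  if 0 < y then P.[y^-1] * expR (- y^-1) else 0.

Lemma exprn_le_expR z i : 0 <= z -> z ^+ i <= i`!%:R * expR z.
Proof.
move=> z0; case: i => [|i]; first by rewrite expr0 fact0 mul1r -expR0 ler_expR.
rewrite mulrC -ler_pdivrMr ?ltr0n ?fact_gt0//.
by apply: le_trans (expR_ge1Dxn i z0); rewrite lerDr.
Qed.

(** The exponential beats every polynomial at infinity. *)
Lemma flat_bounded P : exists C : R, forall y, `|flat P y| <= C.
Proof.
exists (\sum_(i < size P) `|P`_i| * i`!%:R) => y; rewrite /flat.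
have C0 : 0 <= \sum_(i < size P) `|P`_i| * i`!%:R.
  by apply: sumr_ge0 => i _; rewrite mulr_ge0.
case: ifP => [y0|_]; last by rewrite normr0.
rewrite normrM (ger0_norm (expR_ge0 _)) expRN ler_pdivrMr ?expR_gt0//.
rewrite horner_coef mulr_suml (le_trans (ler_norm_sum _ _ _))//.
apply: ler_sum => i _; rewrite normrM -mulrA ler_wpM2l//.
have zy : 0 <= y^-1 by rewrite invr_ge0 ltW.
by rewrite ger0_norm ?exprn_ge0// exprn_le_expR.
Qed.

(** The difference quotient of a flat function at [0] is again flat, which
    gives its continuity and its derivative at [0]. *)
Lemma flat_factor P y : flat P y = flat ('X * P) y * y.
Proof.
rewrite /flat; case: ifP => [y0|_]; last by rewrite mul0r.
rewrite hornerM hornerX; field; by rewrite gt_eqF.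
Qed.

Lemma flat_continuous0 P : {for 0, continuous (flat P)}.
Proof.
have [C HC] := flat_bounded ('X * P).
have f0 : flat P 0 = 0 by rewrite /flat ltxx.
rewrite /prop_for /continuous_at f0; apply/cvgr0Pnorm_le => e e0.
have C1 : 0 < C + 1 by rewrite ltr_wpDl// (le_trans _ (HC 0)).
have d0 : 0 < e / (C + 1) by exact: divr_gt0.
apply: filterS (nbhs0_le (V := R) d0) => y yd; rewrite flat_factor normrM.
apply: (@le_trans _ _ ((C + 1) * (e / (C + 1)))).
  by apply: ler_pM => //; rewrite (le_trans (HC y))// lerDl.
by rewrite mulrC divfK// gt_eqF.
Qed.

(** The class of flat functions is stable under differentiation: this is what
    makes its members smooth across the origin. *)
Lemma is_derive_flat P y : is_derive y 1 (flat P) (flat ('X^2 * (P - P^`())) y).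
Proof.
have [y0|y0|->] := ltgtP y 0.
- rewrite {2}/flat ltNge (ltW y0) /=.
  apply: (@near_eq_is_derive _ _ _ (cst 0)).
    near=> z; rewrite /flat ltNge ifF//.
    apply/negbF/ltW; near: z; exact: lt_nbhsl.
- rewrite {2}/flat y0.
  pose V z : R := z^-1.
  apply: (@near_eq_is_derive _ _ _ ((horner P \o V) * (expR \o (- V)))).
    near=> z; rewrite /flat ifT//; near: z; exact: lt_nbhsr.
  have dV : is_derive y 1 V (- y ^- 2).
    apply: is_derive_eq; first by apply: (@is_deriveV _ id y 1 1); rewrite gt_eqF.
    by rewrite /= [LHS]mulr1.
  apply: is_derive_eq.
  rewrite /= /V -![_ *: _]/(_ * _) !hornerE /=; field.
  by rewrite gt_eqF.
- have -> : flat ('X^2 * (P - P^`())) 0 = 0 :> R by rewrite /flat ltxx.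
  apply/is_derive1_caratheodory; exists (flat ('X * P)); split.
  + by move=> z; rewrite {2}/flat ltxx !subr0 flat_factor.
  + exact: flat_continuous0.
  + by rewrite /flat ltxx.
Unshelve. all: by end_near. Qed.

End Flat.
(** * Test functions approximating the indicator of an interval *)

Section Bump.
Context {R : realType}.
Implicit Types (P : {poly R}) (f g : R -> R) (a c t x y : R).

(** Phrased by recursion on the derivative rather than through [derive1n], so
    that stability under sums and products follows by induction with the Leibniz
    rule. *)
Fixpoint differentiable_upto (k : nat) f : Prop :=
  if k is k'.+1 then (forall x, derivable f x 1) /\ differentiable_upto k' (derive1 f)
  else True.

Lemma differentiable_upto_derive1n k f x :
  differentiable_upto k.+1 f -> derivable (derive1n k f) x 1.
Proof.
elim: k f => [|k IH] f [df dk]; first exact: df.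
by rewrite derive1Sn; exact: IH.
Qed.

Lemma differentiable_uptoW k f :
  differentiable_upto k.+1 f -> differentiable_upto k f.
Proof. by elim: k f => // k IH f [df dk]; split=> //; exact: IH. Qed.

Lemma differentiable_uptoD k f g : differentiable_upto k f ->
  differentiable_upto k g -> differentiable_upto k (f + g).
Proof.
elim: k f g => // k IH f g [df dfk] [dg dgk]; split.
  by move=> x; exact: derivableD.
rewrite (_ : derive1 _ = derive1 f + derive1 g); first exact: IH.
by apply/funext => x; rewrite /= derive1E deriveD// -!derive1E.
Qed.

Lemma differentiable_uptoM k f g : differentiable_upto k f ->
  differentiable_upto k g -> differentiable_upto k (f * g).
Proof.
elim: k f g => // k IH f g dfk dgk.
have [df dfk'] := dfk; have [dg dgk'] := dgk; split.
  by move=> x; exact: derivableM.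
rewrite (_ : derive1 _ = f * derive1 g + g * derive1 f).
  by apply: differentiable_uptoD; apply: IH => //; exact: differentiable_uptoW.
by apply/funext => x; rewrite /= derive1E deriveM// -!derive1E.
Qed.

Lemma is_derive_flat_affine P c a x :
  is_derive x 1 (fun z => flat P (c * z + a))
    (c * flat ('X^2 * (P - P^`())) (c * x + a)).
Proof.
have daff : is_derive x 1 (fun z : R => c * z + a) c.
  apply: (@is_derive_eq _ _ _ (c \*: (id : R -> R) + cst a)).
  by rewrite addr0 [LHS]mulr1.
have df := @is_derive_flat R P (c * x + a).
rewrite [c * flat _ _]mulrC.
exact: (@is_derive1_comp _ (flat P) (fun z => c * z + a) _ _ _ df daff).
Qed.

Lemma flatZ c P y : flat (c *: P) y = c * flat P y.
Proof. by rewrite /flat; case: ifP => _; rewrite ?mulr0// hornerZ mulrA. Qed.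

Lemma differentiable_upto_flat_affine k P c a :
  differentiable_upto k (fun z => flat P (c * z + a)).
Proof.
elim: k P => // k IH P; split=> [x|]; first by case: (is_derive_flat_affine P c a x).
rewrite (_ : derive1 _ = fun z => flat (c *: ('X^2 * (P - P^`()))) (c * z + a))//.
apply/funext => x; rewrite derive1E flatZ.
by case: (is_derive_flat_affine P c a x).
Qed.

Lemma flat1_ge0 y : 0 <= flat 1 y.
Proof. by rewrite /flat; case: ifP => // _; rewrite hornerC mul1r expR_ge0. Qed.

Lemma flat1_le1 y : flat 1 y <= 1.
Proof.
rewrite /flat; case: ifP => // y0; rewrite hornerC mul1r -expR0 ler_expR.
by rewrite oppr_le0 invr_ge0 ltW.
Qed.

Lemma flat1_le0 y : y <= 0 -> flat 1 y = 0.
Proof. by rewrite /flat ltNge => ->. Qed.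

(** [flat 'X^2] is the derivative of [flat 1]. *)
Lemma flatX2_ge0 y : 0 <= flat 'X^2 y.
Proof.
by rewrite /flat; case: ifP => // _; rewrite hornerXn mulr_ge0 ?expR_ge0// sqr_ge0.
Qed.

Lemma flatX2_le0 y : y <= 0 -> flat 'X^2 y = 0.
Proof. by rewrite /flat ltNge => ->. Qed.

Lemma flatX2_le y : flat 'X^2 y <= y ^- 2.
Proof.
rewrite /flat; case: ifP => y0; last by rewrite invr_ge0 sqr_ge0.
rewrite hornerXn exprVn -[leRHS]mulr1 ler_wpM2l ?invr_ge0 ?sqr_ge0//.
by rewrite -expR0 ler_expR oppr_le0 invr_ge0 ltW.
Qed.

(** A smooth function with values in [[0, 1]] and support in
    [[a + 1/c, t - 1/c]], which tends to the indicator of []a, t[] as [c] tends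
    to infinity. The first factor is nondecreasing and the second is
    nonincreasing. The shift by [1] keeps the support inside the open interval. *)
Definition bump a t c x : R := flat 1 (c * (x - a) - 1) * flat 1 (c * (t - x) - 1).

Lemma bumpE a t c : bump a t c =
  (fun x => flat 1 (c * x + (- (c * a) - 1))) *
  (fun x => flat 1 (- c * x + (c * t - 1))).
Proof. by apply/funext => x; rewrite /bump; congr (flat 1 _ * flat 1 _); ring. Qed.

Lemma is_derive_bump_rise a c x : is_derive x 1
  (fun z => flat 1 (c * (z - a) - 1)) (c * flat 'X^2 (c * (x - a) - 1)).
Proof.
have e z : c * (z - a) - 1 = c * z + (- (c * a) - 1) by ring.
under [fun z => _]funext do rewrite e.
rewrite e; have := is_derive_flat_affine 1 c (- (c * a) - 1) x.
by rewrite derivC subr0 mulr1.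
Qed.

Lemma is_derive_bump_fall t c x : is_derive x 1
  (fun z => flat 1 (c * (t - z) - 1)) (- (c * flat 'X^2 (c * (t - x) - 1))).
Proof.
have e z : c * (t - z) - 1 = - c * z + (c * t - 1) by ring.
under [fun z => _]funext do rewrite e.
rewrite e; have := is_derive_flat_affine 1 (- c) (c * t - 1) x.
by rewrite derivC subr0 mulr1 mulNr.
Qed.

Lemma derive1_bump a t c x : derive1 (bump a t c) x =
  c * flat 'X^2 (c * (x - a) - 1) * flat 1 (c * (t - x) - 1) -
  flat 1 (c * (x - a) - 1) * (c * flat 'X^2 (c * (t - x) - 1)).
Proof.
have dr := is_derive_bump_rise a c x; have df := is_derive_bump_fall t c x.
rewrite derive1E; have [_ ->] := is_deriveM dr df.
by rewrite -![_ *: _]/(_ * _); ring.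
Qed.

Lemma test_function_bump lo hi a t c :
  0 < c -> lo <= a -> t <= hi -> test_function lo hi (bump a t c).
Proof.
move=> c0 loa thi; split.
  move=> k x; apply: differentiable_upto_derive1n; rewrite bumpE.
  by apply: differentiable_uptoM; exact: differentiable_upto_flat_affine.
apply: (@subset_trans _ `[a + c^-1, t - c^-1]); last first.
  have ci : 0 < c^-1 by rewrite invr_gt0.
  by move=> x /=; rewrite !in_itv/= => /andP[? ?]; apply/andP; split; lra.
rewrite closureE; apply: smallest_sub; first exact: interval_closed.
move=> x /= /eqP bx; rewrite in_itv /=; apply/andP; split; rewrite leNgt.
- apply/negP => xa; apply: bx; rewrite /bump (@flat1_le0 (c * (x - a) - 1)) ?mul0r//.
  by rewrite subr_le0 mulrC -ler_pdivlMr// mul1r; lra.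
- apply/negP => xa; apply: bx; rewrite /bump (@flat1_le0 (c * (t - x) - 1)) ?mulr0//.
  by rewrite subr_le0 mulrC -ler_pdivlMr// mul1r; lra.
Qed.

Lemma bump_ge0 a t c x : 0 <= bump a t c x.
Proof. by rewrite mulr_ge0 ?flat1_ge0. Qed.

Lemma bump_le1 a t c x : bump a t c x <= 1.
Proof. by rewrite mulr_ile1 ?flat1_ge0 ?flat1_le1. Qed.

Lemma flat1_cvg1 y : 0 < y -> (flat 1 (n.+1%:R * y - 1) : R) @[n --> \oo] --> (1 : R).
Proof.
move=> y0; apply/cvgrPdist_le => e e0; near=> n.
(* 1 - exp (- 1/z) <= 1/z, so it is enough that z >= 1/e. *)
have ye : e^-1 <= n.+1%:R * y - 1.
  rewrite lerBrDr -ler_pdivrMr//.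
  apply: (@le_trans _ _ n%:R); last by rewrite ler_nat.
  by near: n; exact: nbhs_infty_ger.
have z0 : 0 < n.+1%:R * y - 1 by rewrite (lt_le_trans _ ye)// invr_gt0.
rewrite ger0_norm ?subr_ge0 ?flat1_le1// lerBlDl -lerBlDr.
rewrite /flat z0 hornerC mul1r; apply: le_trans (expR_ge1Dx _).
by rewrite lerD2l lerN2 invf_ple ?posrE.
Unshelve. all: by end_near. Qed.

Lemma bump_cvg a t x : (bump a t n.+1%:R x : R) @[n --> \oo] --> (\1_(`]a, t[) x : R).
Proof.
rewrite indicE mem_setE /= in_itv /=.
have out y : y <= 0 -> forall n, flat 1 (n.+1%:R * y - 1) = 0 :> R.
  move=> y0 n; apply: flat1_le0; rewrite subr_le0 (le_trans _ ler01)//.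
  by rewrite mulr_ge0_le0.
have [ax|xa] := ltrP a x; last first.
  under [X in X @ _ --> _]funext do rewrite /bump out ?subr_le0// mul0r.
  exact: cvg_cst.
have [xt|tx] := ltrP x t; last first.
  under [X in X @ _ --> _]funext do rewrite /bump [X in _ * X]out ?subr_le0// mulr0.
  exact: cvg_cst.
rewrite /= -[(true%:R : R)]mulr1.
by apply: cvgM; apply: flat1_cvg1; rewrite subr_gt0.
Qed.

Lemma bump_derivable a t c x : derivable (bump a t c) x 1.
Proof.
have [+ _] : differentiable_upto 1 (bump a t c); last exact.
by rewrite bumpE; apply: differentiable_uptoM; exact: differentiable_upto_flat_affine.
Qed.

Lemma bump_continuous a t c : continuous (bump a t c).
Proof.
by move=> x; apply/differentiable_continuous/derivable1_diffP; exact: bump_derivable.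
Qed.

Lemma differentiable_upto2_continuous f :
  differentiable_upto 2 f -> continuous (derive1 f).
Proof.
by move=> [_ [df _]] x; apply/differentiable_continuous/derivable1_diffP.
Qed.

Lemma derive1_bump_continuous a t c : continuous (derive1 (bump a t c)).
Proof.
apply: differentiable_upto2_continuous; rewrite bumpE.
by apply: differentiable_uptoM; exact: differentiable_upto_flat_affine.
Qed.

End Bump.
(** * Integrals of a weak derivative up to a minimum *)

Section WeakDerivative.
Context {R : realType}.
Local Notation mu := (@lebesgue_measure R).
Implicit Types (f g : R -> R) (lo hi a t : R).

Lemma continuous_integrable_itvoo lo hi f :
  {within `[lo, hi], continuous f} -> mu.-integrable `]lo, hi[ (EFin \o f).
Proof.
move=> cf.
have h : mu.-integrable `[lo, hi] (EFin \o f).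
  by apply: continuous_compact_integrable => //; exact: segment_compact.
by apply: (integrableS _ _ _ h) => //; exact: subset_itv_oo_cc.
Qed.

Lemma Rintegral_derive1_itvoo lo hi f : lo < hi ->
  (forall x, derivable f x 1) -> continuous (derive1 f) ->
  \int[mu]_(x in `]lo, hi[) derive1 f x = f hi - f lo.
Proof.
move=> lohi df cf'.
have cf : continuous f.
  by move=> x; apply/differentiable_continuous/derivable1_diffP.
have cw : {within `[lo, hi], continuous (derive1 f)} by exact: continuous_subspaceT.
have ioo := continuous_integrable_itvoo cw.
have -> : \int[mu]_(x in `]lo, hi[) derive1 f x = \int[mu]_(x in `[lo, hi]) derive1 f x.
  rewrite Rintegral_itv_bndo_bndc// Rintegral_itv_obnd_cbnd//.
  have h : mu.-integrable `[lo, hi] (EFin \o derive1 f).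
    by apply: continuous_compact_integrable => //; exact: segment_compact.
  by apply: (integrableS _ _ _ h) => //; exact: subset_itv_oc_cc.
rewrite /Rintegral (@continuous_FTC2 _ _ f)//.
by split=> //; [apply: cvg_at_right_filter|apply: cvg_at_left_filter]; exact: cf.
Qed.

Lemma bump_test_cvg lo hi g a t :
  mu.-integrable `]lo, hi[ (EFin \o g) -> lo <= a -> t <= hi ->
  (\int[mu]_(x in `]lo, hi[) (g x * bump a t n.+1%:R x)) @[n --> \oo] -->
  \int[mu]_(x in `]a, t[) g x.
Proof.
move=> ig loa thi; set D : set R := (`]lo, hi[)%classic.
have mg : measurable_fun D g by move/integrableP : ig => [/measurable_EFinP].
have mb n : measurable_fun D (bump a t n.+1%:R).
  by apply: measurable_funTS; apply: continuous_measurable_fun; exact: bump_continuous.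
have mgb n : measurable_fun D (fun x => (g x * bump a t n.+1%:R x)%:E).
  by apply/measurable_EFinP; exact: measurable_funM.
have mgi : measurable_fun D (fun x => (g x * \1_(`]a, t[) x)%:E).
  by apply/measurable_EFinP; apply: measurable_funM.
have [||||||_ _] := @dominated_convergence _ _ _ mu D _
    (fun n x => (g x * bump a t n.+1%:R x)%:E) (fun x => (g x * \1_(`]a, t[) x)%:E)
    (fun x => `|g x|%:E).
- exact: measurable_itv.
- exact: mgb.
- exact: mgi.
- apply: aeW => x Dx; apply/cvg_EFin; first by apply: nearW.
  by apply: cvgM; [exact: cvg_cst|exact: bump_cvg].
- exact: (integrable_abse ig).
- apply: aeW => x n Dx; rewrite lee_fin normrM (ger0_norm (bump_ge0 _ _ _ _)).
  by rewrite ler_piMr// bump_le1.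
have at_D : `]a, t[%classic `<=` D.
  by move=> x; rewrite /D /= !in_itv/= => /andP[? ?]; apply/andP; split; lra.
have -> : (\int[mu]_(x in D) (g x * \1_(`]a, t[) x)%:E)%E = (\int[mu]_(x in `]a, t[) g x)%:E.
  have iat : mu.-integrable `]a, t[ (EFin \o g) by exact: integrableS ig.
  rewrite fineK ?integrable_fin_num// -{2}(setIidr at_D) integral_mkcondr.
  apply: eq_integral => x _.
  by rewrite /patch indicE; case: (x \in _); rewrite ?mulr1 ?mulr0.
by move/fine_cvg.
Qed.


(** The weak form of [f t - f a <= 0]. With [phi] the bump function and
    [h = f - f t >= 0], the definition of the weak derivative turns the integral
    of [g * phi] into minus that of [h * phi']. The increasing factor of [phi]
    contributes with a favourable sign. The derivative of the decreasing factor
    has total mass at most [1] and concentrates at [t], where [h] vanishes by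
    continuity. *)
Lemma left_minimum_integral_le0 lo hi f g a t :
  {within `[lo, hi], continuous f} ->
  mu.-integrable `]lo, hi[ (EFin \o g) ->
  is_weak_derivative lo hi f g ->
  lo <= a -> a < t -> t <= hi ->
  (forall s, lo <= s <= t -> f t <= f s) ->
  \int[mu]_(s in `]a, t[) g s <= 0.
Proof.
move=> cf ig wd loa at_ thi fmin.
have lohi : lo < hi by lra.
have [M _ fM] := EVT_max (ltW lohi) cf.
suff H (e : R) : 0 < e -> \int[mu]_(s in `]a, t[) g s <= e.
  by apply/ler_addgt0Pr => e e0; rewrite add0r H.
move=> e0.
have tlh : t \in `[lo, hi] by rewrite in_itv/=; apply/andP; split; lra.
have [r r0 fr] : exists2 r : R, 0 < r &
    forall s, lo <= s <= t -> t - r <= s -> f s - f t <= e / 2.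
  have /subspace_continuousP/(_ t tlh)/cvgrPdist_le/(_ (e / 2)) := cf.
  rewrite divr_gt0// => /(_ isT); rewrite near_withinE => /nbhs_ballP[r /= r0 fr].
  exists (r / 2); first by rewrite divr_gt0.
  move=> s /andP[los st] trs; rewrite (le_trans (ler_norm _))// distrC.
  apply: fr; last by rewrite /= in_itv/=; apply/andP; split; lra.
  by rewrite /ball/= ger0_norm; lra.
pose K := f M - f t.
have K0 : 0 <= K by rewrite subr_ge0 fM.
(* [4 / (c * r ^+ 2)] bounds the slope of the decreasing factor to the left of
   [t - r]; it comes from [flat 'X^2 y <= y ^- 2] at [y >= c * r / 2]. *)
have bnd (c : R) : 2 / r <= c -> \int[mu]_(x in `]lo, hi[) (g x * bump a t c x) <=
    e / 2 + K * (4 / (c * r ^+ 2)) * (hi - lo).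
  move=> rc; set C := K * (4 / _).
  have c0 : 0 < c by rewrite (lt_le_trans _ rc)// divr_gt0.
  pose fall x := flat 1 (c * (t - x) - 1).
  have fallE : fall = (fun x => flat 1 (- c * x + (c * t - 1))).
    by apply/funext => x; rewrite /fall; congr (flat 1 _); ring.
  have fallD k : differentiable_upto k fall.
    by rewrite fallE; exact: differentiable_upto_flat_affine.
  have dfall x : derivable fall x 1 by have [+ _] := fallD 1%N; exact.
  have cfall' : continuous (derive1 fall) by exact: differentiable_upto2_continuous.
  have fall'E x : derive1 fall x = - (c * flat 'X^2 (c * (t - x) - 1)).
    by rewrite derive1E; have [_ ->] := is_derive_bump_fall t c x.
  have tb : test_function lo hi (bump a t c) by exact: test_function_bump.
  have cb : continuous (derive1 (bump a t c)) by exact: derive1_bump_continuous.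
  have cbw : {within `[lo, hi], continuous (derive1 (bump a t c))}.
    exact: continuous_subspaceT.
  have ib := continuous_integrable_itvoo cbw.
  have ifb : mu.-integrable `]lo, hi[ (EFin \o (fun x => f x * derive1 (bump a t c) x)).
    apply: continuous_integrable_itvoo => x.
    by apply: cvgM; [exact: cf|exact: cbw].
  have itb : mu.-integrable `]lo, hi[ (EFin \o (fun x => f t * derive1 (bump a t c) x)).
    apply: continuous_integrable_itvoo => x.
    by apply: cvgM; [exact: cvg_cst|exact: cbw].
  have I0 : \int[mu]_(x in `]lo, hi[) derive1 (bump a t c) x = 0.
    rewrite (Rintegral_derive1_itvoo lohi (@bump_derivable _ a t c) cb).
    have out y : y <= 0 -> flat 1 (c * y - 1) = 0.
      move=> y0; apply: flat1_le0; rewrite subr_le0 (le_trans _ ler01)//.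
      by rewrite pmulr_rle0.
    by rewrite /bump (out (lo - a)) ?(out (t - hi)) ?subr_le0// mul0r mulr0 subrr.
  (* Since [phi'] has integral [0], [f] may be replaced by [f - f t]. *)
  have -> : \int[mu]_(x in `]lo, hi[) (g x * bump a t c x) =
      \int[mu]_(x in `]lo, hi[) (f t * derive1 (bump a t c) x - f x * derive1 (bump a t c) x).
    rewrite RintegralB; [|exact: measurable_itv|exact: itb|exact: ifb].
    rewrite RintegralZl; [|exact: measurable_itv|exact: ib].
    rewrite I0 mulr0 add0r.
    by rewrite (wd _ tb) opprK.
  have ifall : mu.-integrable `]lo, hi[ (EFin \o derive1 fall).
    by apply: continuous_integrable_itvoo; exact: continuous_subspaceT.
  have ifall2 : mu.-integrable `]lo, hi[ (EFin \o (fun x => - (e / 2) * derive1 fall x)).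
    apply: continuous_integrable_itvoo; apply: continuous_subspaceT => x.
    by apply: cvgM; [exact: cvg_cst|exact: cfall'].
  have icst : mu.-integrable `]lo, hi[ (EFin \o (fun x => C)).
    by apply: continuous_integrable_itvoo; apply: continuous_subspaceT => x; exact: cst_continuous.
  apply: (@le_trans _ _ (\int[mu]_(x in `]lo, hi[) (- (e / 2) * derive1 fall x + C))).
    apply: le_Rintegral => //.
    - apply: continuous_integrable_itvoo => x; apply: cvgB.
        by apply: cvgM; [exact: cvg_cst|exact: cbw].
      by apply: cvgM; [exact: cf|exact: cbw].
    - apply: continuous_integrable_itvoo; apply: continuous_subspaceT => x.
      apply: cvgD; last exact: cvg_cst.
      by apply: cvgM; [exact: cvg_cst|exact: cfall'].
    move=> x /=; rewrite in_itv /= => /andP[lox xhi].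
    have C0 : 0 <= C by rewrite mulr_ge0// divr_ge0// mulr_ge0 ?sqr_ge0// ltW.
    rewrite fall'E derive1_bump.
    set A := c * flat _ (c * (x - a) - 1); set Ef := flat _ (c * (t - x) - 1).
    set Er := flat _ (c * (x - a) - 1); set B := c * flat _ _.
    have A0 : 0 <= A by rewrite mulr_ge0 ?flatX2_ge0// ltW.
    have B0 : 0 <= B by rewrite mulr_ge0 ?flatX2_ge0// ltW.
    have Ef0 : 0 <= Ef by exact: flat1_ge0.
    have Er0 : 0 <= Er by exact: flat1_ge0.
    have Er1 : Er <= 1 by exact: flat1_le1.
    have [xt|tx] := ltrP x t; last first.
      have y0 : c * (t - x) - 1 <= 0.
        by rewrite subr_le0 (le_trans _ ler01)// pmulr_rle0//; lra.
      rewrite /Ef /B flat1_le0// flatX2_le0//; lra.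
    have h0 : 0 <= f x - f t by rewrite subr_ge0 fmin//; apply/andP; split; lra.
    have hB : (f x - f t) * B <= e / 2 * B + C.
      have [xr|rx] := ltrP x (t - r); last first.
        apply: ler_wpDr => //; rewrite ler_wpM2r// fr//; apply/andP; split; lra.
      apply: ler_wpDl; first by rewrite mulr_ge0// divr_ge0// ltW.
      apply: ler_pM => //; first by rewrite lerD2r fM// in_itv/=; apply/andP; split; lra.
      have crx : c * r / 2 <= c * (t - x) - 1.
        move: rc; rewrite ler_pdivrMr// => rc; nra.
      have cr0 : 0 < c * r / 2 by rewrite divr_gt0// mulr_gt0.
      apply: (@le_trans _ _ (c * (c * r / 2) ^- 2)).
        rewrite ler_wpM2l ?(ltW c0)// (le_trans (flatX2_le _))//.
        rewrite lef_pV2 ?posrE ?exprn_gt0//; last exact: lt_le_trans crx.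
        by rewrite lerXn2r// nnegrE ltW//; exact: lt_le_trans crx.
      rewrite le_eqVlt; apply/orP; left; apply/eqP; field.
      by rewrite (gt_eqF r0) (gt_eqF c0).
    have EB : (f x - f t) * (Er * B) <= (f x - f t) * B.
      by rewrite ler_wpM2l// ler_piMl.
    have AE : 0 <= (f x - f t) * (A * Ef) by apply: mulr_ge0 => //; exact: mulr_ge0.
    lra.
  rewrite RintegralD// RintegralZl// Rintegral_derive1_itvoo//.
  rewrite (_ : \int[mu]_(_ in `]lo, hi[) C = C * (hi - lo)) ?lerD2r; last first.
    rewrite Rintegral_cst//; congr (_ * _).
    by rewrite [X in fine X](lebesgue_measure_itv `]lo, hi[) /= lte_fin lohi.
  have := flat1_ge0 (c * (t - hi) - 1); have := flat1_le1 (c * (t - lo) - 1).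
  rewrite -/(fall hi) -/(fall lo) => h1 h2; nra.
have cv := bump_test_cvg ig loa thi.
rewrite -(cvg_lim _ cv)//; apply: limr_le.
  by apply/cvg_ex; eexists; exact: cv.
near=> n; apply: le_trans (bnd _ _) _.
  apply: (@le_trans _ _ n%:R); last by rewrite ler_nat.
  by near: n; exact: nbhs_infty_ger.
apply: (@le_trans _ _ (e / 2 + e / 2)); last lra.
rewrite lerD2l.
have n0 : 0 < n.+1%:R :> R by [].
have E (k : R) : 0 < k ->
    K * (4 / (k * r ^+ 2)) * (hi - lo) = (K * 4 * (hi - lo) / r ^+ 2) / k.
  by move=> k0; field; rewrite (gt_eqF r0) (gt_eqF k0).
rewrite E//.
rewrite ler_pdivrMr// [leRHS]mulrC -ler_pdivrMr ?divr_gt0//.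
apply: (@le_trans _ _ n%:R); last by rewrite ler_nat.
by near: n; exact: nbhs_infty_ger.
Unshelve. all: by end_near. Qed.

End WeakDerivative.
(** * Monotone weights *)

Section MonotoneWeight.
Context {R : realType}.
Local Notation mu := (@lebesgue_measure R).
Implicit Types (k g : R -> R) (A : set R) (lo t : R).

(** An upward closed subset of []lo, t[] is an interval ending at [t], with or
    without its left end. *)
Lemma Rintegral_upset_le0 lo t g A :
  mu.-integrable `]lo, t[ (EFin \o g) ->
  (forall a, lo <= a -> a < t -> \int[mu]_(s in `]a, t[) g s <= 0) ->
  A `<=` `]lo, t[ ->
  (forall s s', A s -> s <= s' -> s' < t -> A s') ->
  \int[mu]_(s in A) g s <= 0.
Proof.
move=> ig g_le0 Asub Aup.
have [->|A0] := eqVneq A set0; first by rewrite Rintegral_set0.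
have {}A0 : A !=set0 by exact/set0P.
have lbA : has_lbound A.
  by exists lo => s /Asub; rewrite /= in_itv/= => /andP[/ltW].
have loc : lo <= inf A.
  by apply: lb_le_inf => // s /Asub; rewrite /= in_itv/= => /andP[/ltW].
have ct : inf A < t.
  have [s As] := A0; apply: (@le_lt_trans _ _ s); first exact: ge_inf.
  by have := Asub _ As; rewrite /= in_itv/= => /andP[].
have ioA : `]inf A, t[ `<=` A.
  move=> s; rewrite /= in_itv/= => /andP[cs st].
  have [s' As' s's] := inf_lt A0 cs.
  by apply: (Aup s') => //; exact: ltW.
have iinf : mu.-integrable `]inf A, t[ (EFin \o g).
  apply: (integrableS _ _ _ ig) => //.
  by move=> s /=; rewrite !in_itv/= => /andP[? ?]; apply/andP; split; lra.
suff -> : \int[mu]_(s in A) g s = \int[mu]_(s in `]inf A, t[) g s by exact: g_le0.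
have Aic s : A s -> inf A <= s < t.
  move=> As; rewrite ge_inf//=.
  by have := Asub _ As; rewrite /= in_itv/= => /andP[].
have [cA|cA] := pselect (A (inf A)).
  rewrite Rintegral_itv_obnd_cbnd//; congr (Rintegral mu _ g).
  apply/seteqP; split => s /=; rewrite in_itv/=; first exact: Aic.
  by move=> /andP[cs st]; exact: (Aup _ _ cA).
congr (Rintegral mu _ g); apply/seteqP; split=> // s As /=.
have /andP[cs st] := Aic _ As; rewrite in_itv/= st andbT lt_neqAle cs andbT.
by apply/eqP => csE; apply: cA; rewrite csE.
Qed.

(** Layer-cake argument: [k s] is the length of [[0, k s]], so by Fubini the
    integral of [k * g] is the integral over [l >= 0] of the integrals of [g]
    over the superlevel sets of [k], and these sets are upward closed. *)
Lemma monotone_weight_integral_le0 lo t k g :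
  measurable_fun `]lo, t[ k -> (forall s, lo < s < t -> 0 <= k s) ->
  (forall s s', lo < s -> s <= s' -> s' < t -> k s <= k s') ->
  mu.-integrable `]lo, t[ (EFin \o g) ->
  mu.-integrable `]lo, t[ (EFin \o (fun s => k s * g s)) ->
  (forall a, lo <= a -> a < t -> \int[mu]_(s in `]a, t[) g s <= 0) ->
  \int[mu]_(s in `]lo, t[) (k s * g s) <= 0.
Proof.
move=> mk k0 kmono ig ikg g_le0; set D : set R := `]lo, t[%classic.
have mD : measurable D by exact: measurable_itv.
have mg : measurable_fun D g by move/integrableP : ig => [/measurable_EFinP].
pose K : R -> R := k \_ D; pose G : R -> R := g \_ D.
have mK : measurable_fun setT K by apply/(measurable_restrictT _ mD).
have mG : measurable_fun setT G by apply/(measurable_restrictT _ mD).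
have K0 s : 0 <= K s.
  rewrite /K patchE; case: ifPn => //; rewrite inE => Ds; apply: k0.
  by move: Ds; rewrite /D/= in_itv.
pose S : set (R * R) := [set p | 0 <= p.2 /\ p.2 <= K p.1].
have mS : measurable S.
  have -> : S = (setT `&` [set p | 0 <= p.2]) `&` (setT `&` [set p | p.2 <= K p.1]).
    by rewrite !setTI.
  apply: measurableI; apply: measurable_fun_le => //.
  exact: measurableT_comp.
pose f (p : R * R) : \bar R := (G p.1 * \1_S p)%:E.
have mf : measurable_fun setT f.
  apply/measurable_EFinP; apply: measurable_funM.
    exact: measurableT_comp.
  exact: measurable_indic.
have indS c s : (\int[mu]_l (c * \1_S (s, l))%:E = (c * K s)%:E)%E.
  have -> : (fun l => (c * \1_S (s, l))%:E) = ((cst c%:E) \_ `[0%R, K s]).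
    apply/funext => l; rewrite patchE indicE /S.
    have -> : ((s, l) \in S) = (l \in `[0%R, K s]%classic).
      by apply/idP/idP; rewrite !inE /= in_itv/= => /andP.
    by case: ifP => _ /=; rewrite ?mulr1 ?mulr0.
  rewrite -integral_mkcond integral_cst//.
  rewrite [X in (_ * X)%E](lebesgue_measure_itv `[0%R, K s]) /= lte_fin.
  have [Ks|Ks] := ltrP 0 (K s); first by rewrite oppr0 adde0.
  have -> : K s = 0 by apply/eqP; rewrite eq_le Ks K0.
  by rewrite mule0 mulr0.
have GK : (fun s => (G s * K s)%:E) = (fun s => (k s * g s)%:E) \_ D.
  apply/funext => s; rewrite /G /K !patchE; case: ifP => _; last by rewrite mulr0.
  by rewrite mulrC.
have /(integrable12ltyP mu mu mf) ff : (\int[mu]_s \int[mu]_l `|f (s, l)| < +oo)%E.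
  under eq_integral => s _.
    rewrite (_ : (fun l => _) = (fun l => (`|G s| * \1_S (s, l))%:E)); last first.
      by apply/funext => l; rewrite /f/= normrM indicE normr_nat.
    rewrite indS (_ : (`|G s| * K s)%:E = `|(G s * K s)%:E|%E); last first.
      by rewrite /= normrM (ger0_norm (K0 _)).
    over.
  have -> : (fun s => `|(G s * K s)%:E|)%E = (fun s => `|(k s * g s)%:E|)%E \_ D.
    apply/funext => s; rewrite -[(G s * K s)%:E]/((fun s => (G s * K s)%:E) s).
    by rewrite GK !patchE; case: ifP => _ //=; rewrite normr0.
  by rewrite -integral_mkcond; have /integrableP[] := ikg.
have E := Fubini ff.
rewrite /Rintegral.
have -> : (\int[mu]_(s in D) (k s * g s)%:E = \int[mu]_s \int[mu]_l f (s, l))%E.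
  by rewrite integral_mkcond -GK; apply: eq_integral => s _; rewrite -indS.
rewrite E.
have inner l : (\int[mu]_s f (s, l) <= 0)%E.
  have [l0|l0] := ltrP l 0.
    rewrite integral0_eq; first exact: lexx.
    move=> s _; rewrite /f indicE memNset; last by move=> [/=]; rewrite leNgt l0.
    by rewrite mulr0.
  pose A := D `&` [set s | l <= k s].
  have mA : measurable A by exact: measurable_fun_le.
  have iA : mu.-integrable A (EFin \o g).
    by apply: (integrableS _ _ _ ig); [exact: measurable_itv|exact: mA|exact: subIsetl].
  rewrite (_ : (\int[mu]_s _)%E = (\int[mu]_(s in A) g s)%:E); last first.
    rewrite fineK ?integrable_fin_num// integral_mkcond; apply: eq_integral => s _.
    rewrite /f /G !patchE indicE.
    have -> : (s \in A) = (s \in D) && ((s, l) \in S).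
      apply/idP/andP; rewrite !inE /A /S /= /K patchE.
        by move=> [Ds ls]; rewrite (mem_set Ds).
      by move=> [Ds [_]]; rewrite (mem_set Ds).
    by case: (s \in D); case: (_ \in S); rewrite /= ?(mul0r, mulr0, mulr1).
  rewrite lee_fin; apply: (Rintegral_upset_le0 ig g_le0).
    exact: subIsetl.
  move=> s s' [Ds ls] ss' s't; split.
    by move: Ds; rewrite /D /= !in_itv/= s't andbT => /andP[los _]; exact: lt_le_trans ss'.
  move: Ds; rewrite /D /= in_itv/= => /andP[los _].
  by rewrite (le_trans ls)// kmono.
suff : (\int[mu]_l \int[mu]_s f (s, l) <= 0)%E by case: (integral _ _ _).
have negN l : setT l -> (0 <= - \int[mu]_s f (s, l))%E by rewrite oppe_ge0.
have := integral_ge0N mu negN.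
under eq_integral do rewrite oppeK.
by move=> ->; rewrite oppe_le0; exact: integral_ge0.
Qed.

End MonotoneWeight.
(** * The Hadamard derivative at a minimum *)

Section HadamardMinimum.
Context {R : realType}.
Local Notation mu := (@lebesgue_measure R).
Implicit Types (f g : R -> R) (alpha T t lo hi : R).

(** Comparison with [f ^+ 2 + 1], which is integrable on a bounded interval. *)
Lemma in_L2_integrable lo hi f : in_L2 lo hi f -> mu.-integrable `]lo, hi[ (EFin \o f).
Proof.
set D : set R := `]lo, hi[%classic => f2.
have mD : measurable D by exact: measurable_itv.
have mf : measurable_fun setT (f \_ D) by move: f2; rewrite /in_L2 inE => /andP[]; rewrite inE.
have {}mf : measurable_fun D f by apply/(measurable_restrictT _ mD).
have isq : mu.-integrable D (EFin \o (fun x => (f \_ D) x ^+ 2)).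
  by apply: (integrableS _ _ _ (Lfun2_integrable_sqr f2)) => //.
have i1 : mu.-integrable D (EFin \o (fun=> 1)).
  by apply: continuous_integrable_itvoo; apply: continuous_subspaceT => x; exact: cvg_cst.
have mEf : measurable_fun D (EFin \o f) by exact/measurable_EFinP.
have is1 : mu.-integrable D (EFin \o (fun x => (f \_ D) x ^+ 2 + 1)).
  by have := integrableD _ isq i1; apply; exact: measurable_itv.
apply: (le_integrable _ _ _ is1) => // x Dx /=.

rewrite lee_fin patchE mem_set// [leRHS]ger0_norm; last by rewrite addr_ge0// sqr_ge0.
rewrite -real_normK ?num_real//; have := sqr_ge0 (`|f x| - 1); have := normr_ge0 (f x).
nra.
Qed.

Lemma Gamma_ge0 (a : R) : 0 <= Gamma a.
Proof. by apply: Rintegral_ge0 => x _; rewrite mulr_ge0 ?powR_ge0 ?expR_ge0. Qed.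

Lemma hadamard_weight_ndecr alpha t s s' : 0 <= alpha -> 0 < s -> s <= s' -> s' < t ->
  ln (t / s) `^ (- alpha) <= ln (t / s') `^ (- alpha).
Proof.
move=> a0 s0 ss' s't; rewrite !powRN.
have s'0 : 0 < s' by exact: lt_le_trans ss'.
have lns' : 0 < ln (t / s') by rewrite ln_gt0// ltr_pdivlMr// mul1r.
have lnss' : ln (t / s') <= ln (t / s).
  rewrite ler_ln ?posrE ?divr_gt0//; try lra.
  rewrite ler_wpM2l//; first lra.
  by rewrite lef_pV2.
rewrite lef_pV2 ?posrE ?powR_gt0//; last exact: lt_le_trans lnss'.
by rewrite ge0_ler_powR// nnegrE ltW//; exact: lt_le_trans lnss'.
Qed.

(** Extremum principle: the kernel is a nondecreasing weight on []1, t[], and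
    the integral of the weak derivative up to [t] is nonpositive from any
    starting point. *)
Lemma hadamard_le0_at_min alpha T f t :
  0 <= alpha -> 1 < t <= T ->
  {within `[1, T], continuous f} -> in_W12 1 T f ->
  hadamard_converges alpha T f t ->
  (forall s, 1 <= s <= t -> f t <= f s) ->
  hadamard alpha T f t <= 0.
Proof.
move=> a0 /andP[t1 tT] cf [_ [g0 g02 wd0]] conv fmin.
have [g2 wd] : in_L2 1 T (weak_derivative 1 T f) /\
    is_weak_derivative 1 T f (weak_derivative 1 T f).
  have ex : [set g | in_L2 1 T g /\ is_weak_derivative 1 T f g] !=set0 by exists g0.
  by have := @xgetPex _ (cst 0) _ ex.
have ig := in_L2_integrable g2.
rewrite /hadamard mulr_ge0_le0// ?invr_ge0 ?Gamma_ge0//.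
set g := weak_derivative 1 T f in g2 wd ig *.
have ioo : mu.-integrable `]1, t[ (EFin \o hadamard_integrand alpha T f t).
  by apply: (integrableS _ _ _ conv) => //; exact: subset_itv_oo_cc.
have ioc : mu.-integrable `]1, t] (EFin \o hadamard_integrand alpha T f t).
  by apply: (integrableS _ _ _ conv) => //; exact: subset_itv_oc_cc.
rewrite -Rintegral_itv_obnd_cbnd// -Rintegral_itv_bndo_bndc//.
apply: monotone_weight_integral_le0 => //.
- have lnE s : s \in (`]1, t[)%classic -> ln (t / s) `^ (- alpha) = (ln t - ln s) `^ (- alpha).
    by rewrite inE/= in_itv/= => /andP[s1 st]; rewrite ln_div// posrE; lra.
  apply: (eq_measurable_fun (fun s => (ln t - ln s) `^ (- alpha))) => [s sin|].
    by rewrite lnE.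
  apply: measurable_funTS.
  apply: (@measurableT_comp _ _ _ _ _ _ (@powR R ^~ (- alpha))) => //.
  by apply: measurable_funB => //; exact: measurable_ln.
- by move=> s _; exact: powR_ge0.
- move=> s s' s1 ss' s't; apply: hadamard_weight_ndecr => //; lra.
- apply: (integrableS _ _ _ ig) => //.
  by move=> s /=; rewrite !in_itv/= => /andP[? ?]; apply/andP; split; lra.
- by move=> a a1 at_; exact: (left_minimum_integral_le0 cf ig wd).
Qed.

End HadamardMinimum.
(** * The Laplacian at a minimum *)

Section LaplacianMinimum.
Context {R : realType}.
Implicit Types (p : R -> R).

(** The first derivative is given as a function [p1] near [0] only, as this is
    all that is known for a function on an open set restricted to a line. *)
Lemma second_derivative_min (p p1 : R -> R) (l d : R) : 0 < d ->
  (forall s, `|s| < d -> is_derive (s : R) (1 : R) p (p1 s)) ->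
  is_derive (0 : R) (1 : R) p1 l ->
  (forall s, `|s| < d -> p 0 <= p s) ->
  0 <= l.
Proof.
move=> d0 dp dp1 pmin; rewrite leNgt; apply/negP => l0.
have ind s : s \in `]- d, d[ -> `|s| < d.
  by rewrite in_itv/= ltr_norml.
have p10 : p1 0 = 0.
  have /dp[_ <-] : `|0 : R| < d by rewrite normr0.
  have dd : - d <= d by lra.
  have dpi s : s \in `]- d, d[ -> derivable p s 1 by move=> /ind /dp[].
  have in0 : 0 \in `]- d, d[ by rewrite in_itv/=; apply/andP; split; lra.
  have pm s : s \in `]- d, d[ -> p 0 <= p s by move=> /ind /pmin.
  by have [_ ->] := derive1_at_min dd dpi in0 pm.
have [g [p1E gc g0]] := (is_derive1_caratheodory _ _ _).1 dp1.
have : \forall z \near (0:R), g z < 0.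
  by move: gc; rewrite /prop_for/continuous_at g0 => /cvgr_lt; exact.
move=> /nbhs_ballP[r /= r0 gneg].
pose m := Num.min r d / 2.
have m0 : 0 < m by rewrite divr_gt0// lt_min r0 d0.
have mr : m < r.
  by rewrite /m; have : Num.min r d <= r by [rewrite ge_min lexx]; lra.
have md : m < d.
  by rewrite /m; have : Num.min r d <= d by [rewrite ge_min lexx orbT]; lra.
have [||c] := @MVT _ p p1 0 m m0.
- move=> s; rewrite in_itv/= => /andP[s0 sm]; apply: dp; rewrite ger0_norm; lra.
- apply: derivable_within_continuous => s; rewrite in_itv/= => /andP[s0 sm].
  by have [] := dp s _; first by rewrite ger0_norm; lra.
rewrite in_itv/= => /andP[c0 cm] pm.
have gc0 : g c < 0 by apply: gneg; rewrite /ball/= sub0r normrN ger0_norm; lra.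
have := p1E c; rewrite p10 !subr0 => p1c.
have := pmin m _; rewrite ger0_norm ?(ltW m0)// => /(_ md).
rewrite -subr_ge0 pm p1c subr0 leNgt => /negP; apply.
by rewrite pmulr_llt0// pmulr_llt0.
Qed.

Lemma is_derive_line (V : normedModType R) (f : V -> R) (x v : V) (s : R) :
  derivable f (s *: v + x) v ->
  is_derive (s : R) (1 : R) (fun h => f (h *: v + x)) ('D_v f (s *: v + x)).
Proof.
move=> df.
have E : (fun h : R => h^-1 *: (((fun h => f (h *: v + x)) \o shift s) (h *: 1) - f (s *: v + x)))
  = (fun h => h^-1 *: ((f \o shift (s *: v + x)) (h *: v) - f (s *: v + x))).
  by apply/funext => h /=; rewrite [_%:A]mulr1 scalerDl addrA.
by apply: DeriveDef; rewrite /derivable /derive E.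
Qed.

Context {n : nat}.
Implicit Types (G : set 'rV[R]_n) (f : 'rV[R]_n -> R) (x : 'rV[R]_n).

Definition sqnorm x : R := \sum_(i < n) x 0 i ^+ 2.

Lemma sqnorm_ge0 x : 0 <= sqnorm x.
Proof. by apply: sumr_ge0 => i _; exact: sqr_ge0. Qed.

Lemma sqnorm_line x i s :
  sqnorm (s *: delta_mx 0 i + x) = sqnorm x + (2 * x 0 i * s + s ^+ 2).
Proof.
rewrite /sqnorm (bigD1 i)//= [X in _ = X + _](bigD1 i)//= !mxE !eqxx /=.
rewrite (eq_bigr (fun j => x 0 j ^+ 2)); first ring.
by move=> j ji; rewrite !mxE (negbTE ji) andbF mulr0 add0r.
Qed.

Lemma sqnorm_continuous : continuous sqnorm.
Proof.
rewrite /sqnorm; elim: (index_enum _) => [|i r IH].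
  by under eq_fun do [rewrite big_nil]; exact: cst_continuous.
under eq_fun do rewrite big_cons expr2; move=> x.
have ci : {for x, continuous (fun y : 'rV[R]_n => y 0 i)} by exact: coord_continuous.
exact: (continuousD (continuousM ci ci) (IH x)).
Qed.


Lemma line_nbhs G x i : open G -> G x ->
  exists2 d : R, 0 < d & forall s, `|s| < d -> G (s *: delta_mx 0 i + x).
Proof.
move=> oG Gx.
have : \forall s \near (0 : R), G (s *: (delta_mx 0 i : 'rV[R]_n) + x).
  have : {for (0 : R), continuous (fun s : R => s *: (delta_mx 0 i : 'rV[R]_n) + x)}.
    by apply: cvgD; [apply: cvgZr_tmp; exact: cvg_id|exact: cvg_cst].
  rewrite /prop_for/continuous_at scale0r add0r; apply.
  exact: open_nbhs_nbhs.
move=> /nbhs_ballP[d /= d0 H]; exists d => // s sd; apply: H.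
by rewrite /ball/= sub0r normrN.
Qed.

(** Along the line [s *: e_i + x] the term [sqnorm] equals a constant plus
    [2 * x_i * s + s ^+ 2], whose second derivative is [2]. *)
Lemma partial2_ge_at_min G f x eps i : open G -> Ck 2 G f -> G x ->
  (forall y, G y -> f x - eps * sqnorm x <= f y - eps * sqnorm y) ->
  2 * eps <= partial i (partial i f) x.
Proof.
move=> oG [_ /(_ i)[df [_ /(_ i)[ddf _]]]] Gx fmin.
have [d d0 Gd] := line_nbhs i oG Gx.
pose e : 'rV[R]_n := delta_mx 0 i; pose c := x 0 i.
pose p (s : R) := f (s *: e + x) - eps * (2 * c * s + s ^+ 2).
pose p1 (s : R) := partial i f (s *: e + x) - eps * (2 * c + 2 * s).
rewrite -subr_ge0; apply: (@second_derivative_min p p1 _ d d0).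
- move=> s sd.
  have d1 := is_derive_line (df _ (Gd _ sd)).
  have d2 : is_derive (s : R) (1 : R)
      (fun s : R => eps * (2 * c * s + s ^+ 2)) (eps * (2 * c + 2 * s)).
    apply: (@is_derive_eq _ _ _ (eps \*: ((2 * c) \*: (id : R -> R) + (id : R -> R) ^+ 2))).
    by rewrite -![_ *: _]/(_ * _) /=; ring.
  exact: is_deriveB.
- have d1 : is_derive (0:R) 1 (fun h : R => partial i f (h *: e + x)) (partial i (partial i f) x).
    have := @is_derive_line _ (partial i f) x e 0.
    by rewrite scale0r add0r; apply; exact: ddf.
  have d2 : is_derive (0:R) 1 (fun s : R => eps * (2 * c + 2 * s)) (2 * eps).
    apply: (@is_derive_eq _ _ _ (eps \*: (cst (2 * c) + 2 \*: (id : R -> R)))).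
    by rewrite -![_ *: _]/(_ * _) /=; ring.
  exact: is_deriveB.
- move=> s sd; rewrite /p scale0r add0r mulr0 expr0n/= addr0 mulr0 subr0.
  have := fmin _ (Gd _ sd); rewrite sqnorm_line -/c -/e; lra.
Qed.

Lemma laplacian_gt0_at_min G f x eps : (0 < n)%N -> 0 < eps ->
  open G -> Ck 2 G f -> G x ->
  (forall y, G y -> f x - eps * sqnorm x <= f y - eps * sqnorm y) ->
  0 < laplacian f x.
Proof.
move=> n0 eps0 oG cf Gx fmin.
apply: (@lt_le_trans _ _ (\sum_(i < n) 2 * eps)).
  by rewrite sumr_const card_ord pmulrn_lgt0// mulr_gt0.
by apply: ler_sum => i _; exact: (partial2_ge_at_min i oG cf).
Qed.

End LaplacianMinimum.
(** * The parabolic minimum principle *)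

Section Domain.
Context {R : realType} {n : nat}.
Implicit Types (G : set 'rV[R]_n) (v : 'rV[R]_n -> R -> R).

Lemma bounded_closure_compact G : bounded_set G -> compact (closure G).
Proof.
move=> [M [Mreal GM]]; apply: bounded_closed_compact; last exact: closed_closure.
exists (M + 1); split; first exact: num_real.
move=> r Mr; rewrite /= closureE; apply: smallest_sub.
  apply: (@closed_comp _ _ (Num.norm : 'rV[R]_n -> R) [set y | y <= r]).
    by move=> x _; exact: norm_continuous.
  exact: closed_le.
by move=> x Gx; apply: GM => //; lra.
Qed.

Lemma boundary_compact G : compact (closure G) -> compact (boundary G).
Proof.
move=> cG; apply: (subclosed_compact _ cG); last by move=> x [].
apply: closedI; first exact: closed_closure.
by apply: open_closedC; exact: open_interior.
Qed.

(** A point of the closure with the largest first coordinate is a boundary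
    point, for an interior point could be pushed further. *)
Lemma boundary_neq0 G : (0 < n)%N -> open G -> G !=set0 -> compact (closure G) ->
  boundary G !=set0.
Proof.
move=> n0 oG [x Gx] cG; pose i := Ordinal n0.
have cl0 : closure G !=set0 by exists x; exact: subset_closure.
have [c] := EVT_max_rV cl0 cG (continuous_subspaceT (@coord_continuous R 1 n 0 i)).
rewrite inE => clc cmax; exists c; split=> // intc.
have [d d0 Gd] := line_nbhs i oG (interior_subset intc).
have dh : `|d / 2| < d by rewrite ger0_norm; lra.
have := cmax _ (mem_set (subset_closure (Gd _ dh))).
by rewrite !mxE !eqxx mulr1; lra.
Qed.

Lemma continuous_cyl_slice A (T : R) v (x : 'rV[R]_n) : A x ->
  continuous_cyl A T v -> {within `[1, T], continuous (v x)}.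
Proof.
move=> Ax /subspace_continuousP cv; apply/subspace_continuousP => s sT.
have cvs := cv (x, s) (conj Ax sT).
have cpair : {for s, continuous (fun s' : R => (x, s'))}.
  have cx : x @[s' --> s] --> x by exact: cvg_cst.
  exact: (cvg_pair cx cvg_id).
move=> B /cvs /cpair near_s.
suff : \forall s' \near s, `[1, T]%classic s' -> B (v x s') by [].
apply: (@filterS _ (nbhs s) _ _ _ _ near_s) => s' vB s'T.
by apply: vB; split.
Qed.

Lemma continuous_cyl_min A (T : R) v : 1 <= T -> A !=set0 -> compact A ->
  continuous_cyl A T v ->
  exists m, is_min (A `*` `[1, T]) (fun p : 'rV[R]_n * R => v p.1 p.2) m.
Proof.
move=> T1 [x Ax] cA cv.
have K0 : (A `*` `[1, T]) !=set0 by exists (x, 1); split=> //=; rewrite in_itv/= lexx.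
have cK : compact (A `*` `[1, T]) by apply: compact_setX => //; exact: segment_compact.
have [c] := compact_EVT_min K0 cK cv.
rewrite inE => cin cmin; exists (v c.1 c.2); split; first by exists c.
by move=> p pK; apply: cmin; rewrite inE.
Qed.

End Domain.

Theorem theorem4p1 (R : realType) (n : nat) (alpha nu T : R)
    (G : set 'rV[R]_n) (F : 'rV[R]_n -> R -> R)
    (phi : 'rV[R]_n -> R) (psi u : 'rV[R]_n -> R -> R) :
  (0 < n)%N ->
  0 < alpha < 1 -> 0 < nu -> 1 < T ->
  bounded_domain G -> smooth_boundary G ->
  continuous_cyl (closure G) T F ->
  {within closure G, continuous phi} ->
  continuous_cyl (boundary G) T psi ->
  classical_solution G alpha nu T F u ->
  (forall x, closure G x -> u x 1 = phi x) ->
  (forall x t, boundary G x -> 1 <= t <= T -> u x t = psi x t) ->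
  (forall x t, closure G x -> 1 <= t <= T -> 0 <= F x t) ->
  exists mpsi mphi : R,
    [/\ is_min (boundary G `*` `[1, T]) (fun p : 'rV[R]_n * R => psi p.1 p.2) mpsi,
        is_min (closure G) phi mphi &
        forall x t, closure G x -> 1 <= t <= T ->
          Num.min mpsi mphi <= u x t].
Proof.
move=> n0 /andP[alpha0 _] nu0 T1 [oG _ G0 bG] _ _ cphi cpsi
  [cu uC2 uW12 uconv ueq] uphi upsi F0.
have cG := bounded_closure_compact bG.
have clG0 : closure G !=set0.
  by have [x Gx] := G0; exists x; exact: subset_closure.
have [mpsi minpsi] := continuous_cyl_min (ltW T1) (boundary_neq0 n0 oG G0 cG)
  (boundary_compact cG) cpsi.
have [xphi] := EVT_min_rV clG0 cG cphi.
rewrite inE => xphiG phimin.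
exists mpsi, (phi xphi); split=> //.
  by split; [exists xphi|move=> x xG; apply: phimin; rewrite inE].
set m := Num.min _ _ => x0 t0 x0G t0T; rewrite leNgt; apply/negP => um.
pose K : set ('rV[R]_n * R) := closure G `*` `[1, T].
have [xq] := EVT_max_rV clG0 cG (continuous_subspaceT (@sqnorm_continuous R n)).
rewrite inE => xqG qmax.
pose C := sqnorm xq + 1.
have C0 : 0 < C by rewrite ltr_wpDl// sqnorm_ge0.
have qC x : closure G x -> sqnorm x <= C.
  by move=> xG; rewrite (le_trans (qmax _ (mem_set xG)))// lerDl.
(* The perturbation lowers u by at most half of the gap m - u x0 t0, so the
   perturbed function still has its minimum off the parabolic boundary. *)
pose eps := (m - u x0 t0) / (2 * C).
have eps0 : 0 < eps by rewrite divr_gt0 ?subr_gt0// mulr_gt0.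
have epsC : eps * C = (m - u x0 t0) / 2 by rewrite /eps; field; exact: lt0r_neq0.
have cv : continuous_cyl (closure G) T (fun x t => u x t - eps * sqnorm x).
  have cs : continuous (fun p : 'rV[R]_n * R => eps * sqnorm p.1).
    move=> p; apply: (@continuousM _ _ (cst eps) (@sqnorm R n \o fst)).
      exact: cst_continuous.
    by apply: continuous_comp; [exact: cvg_fst|exact: sqnorm_continuous].
  have csK : {within K, continuous (fun p : 'rV[R]_n * R => eps * sqnorm p.1)}.
    exact: continuous_subspaceT.
  by move=> p; apply: cvgB; [exact: cu|exact: csK].
have [v0 [[[x1 t1] [/= x1G t1T] v1E] vmin]] := continuous_cyl_min (ltW T1) clG0 cG cv.
move: t1T; rewrite in_itv /= => t1T.
have vm : u x1 t1 - eps * sqnorm x1 <= u x0 t0.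
  have x0K : closure G x0 /\ t0 \in `[1, T] by rewrite in_itv.
  rewrite v1E; apply: le_trans (vmin (x0, t0) x0K) _ => /=.
  by rewrite gerBl mulr_ge0 ?sqnorm_ge0// ltW.
have u1m : u x1 t1 < m.
  have : eps * sqnorm x1 <= eps * C by rewrite ler_wpM2l ?qC// ltW.
  lra.
have Gx1 : G x1.
  apply: contrapT => nGx1; have bx1 : boundary G x1.
    by split=> // /interior_subset.
  have := minpsi.2 (x1, t1); rewrite /= -upsi//.
  have : m <= mpsi by rewrite /m ge_min lexx.
  have : (boundary G `*` `[1, T]) (x1, t1) by split=> //=; rewrite in_itv.
  move=> h1 h2 /(_ h1); lra.
have t11 : 1 < t1 <= T.
  have /andP[t1ge ->] := t1T; rewrite andbT lt_neqAle t1ge andbT.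
  apply/eqP => t1E; have := u1m; rewrite -t1E uphi// ltNge => /negP; apply.
  by rewrite /m ge_min phimin ?orbT// inE.
have lap : 0 < laplacian (u^~ t1) x1.
  apply: (@laplacian_gt0_at_min _ _ G _ _ eps) => //; first exact: uC2.
  move=> y Gy; rewrite v1E; apply: (vmin (y, t1)).
  by split=> /=; [exact: subset_closure|rewrite in_itv].
have had : hadamard alpha T (u x1) t1 <= 0.
  apply: hadamard_le0_at_min => //.
  - exact: ltW.
  - exact: continuous_cyl_slice cu.
  - exact: uW12.
  - exact: uconv.
  - move=> s /andP[s1 st1]; have := vmin (x1, s).
    rewrite -v1E /= lerD2r; apply; split=> //=.
    by rewrite in_itv/= s1 (le_trans st1)//; case/andP: t1T.
have := F0 x1 t1 x1G t1T; have := mulr_gt0 nu0 lap.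
have := ueq x1 t1 Gx1 t11; lra.
Qed.
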